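(* Let $A\in\mathbb{R}^{m\times n}$, $\sigma>0$, $\epsilon\in(0,1)$, an uncertainty set $\mathcal{U}\subset\mathbb{R}^m$ and a positive integer $s\le n$ be given. Let $H=[h_1,\dots,h_n]\in\mathbb{R}^{m\times n}$ satisfy the condition $\mathbf{H}_{s,\infty}(\kappa)$ for some $\kappa<1/2$, let $\theta=2$, and let $\widehat{x}_{\rm pen}(\cdot)$ be the penalized $\ell_1$-recovery associated with $H,s,\theta$. Let $\nu(H)=\max_i\nu(h_i)$. Then there exists a set $\Xi\subset\mathbb{R}^m$ with $\mathrm{Prob}\{\xi\in\Xi\}\ge1-\epsilon$ (where $\xi\sim N(0,I_m)$) such that whenever $\xi\in\Xi$, for every $x\in\mathbb{R}^n$ and every $u\in\mathcal{U}$ one has $$\|\widehat{x}_{\rm pen}(Ax+\sigma\xi+u)-x\|_1\le\frac{2\|x-x^s\|_1}{1-2\kappa}+4s\frac{\nu(H)}{1-2\kappa},$$ $$\|\widehat{x}_{\rm pen}(Ax+\sigma\xi+u)-x\|_\infty\le 2s^{-1}\frac{\|x-x^s\|_1}{1-2\kappa}+\frac{4\nu(H)}{1-2\kappa}.$$ In particular, for all $1\le p\le\infty$ and $\upsilon\ge0$, $$\mathrm{Risk}_p(\widehat{x}_{\rm pen}(\cdot)\,|\,\epsilon,\sigma,s,\upsilon)\le\frac{2s^{1/p}}{1-2\kappa}\left(s^{-1}\upsilon+2\nu(H)\right).$$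
   Context: Observation model: $y=Ax+u+\sigma\xi\in\mathbb{R}^m$, where $A\in\mathbb{R}^{m\times n}$ is known, $x\in\mathbb{R}^n$ is an unknown signal, $\xi\sim N(0,I_m)$, $\sigma>0$ is known, and $u$ is an unknown nuisance belonging to a known (nonempty) convex compact set $\mathcal{U}\subset\mathbb{R}^m$ symmetric with respect to the origin. For $x\in\mathbb{R}^n$ and $1\le s\le n$, $x^s$ is the vector obtained from $x$ by setting to $0$ all but the $s$ largest in magnitude entries (ties are resolved in favour of smaller indices). $\nu(v)=\nu_{\epsilon,\sigma,\mathcal U}(v)=\sup_{u\in\mathcal{U}}u^Tv+\sigma\sqrt{2\ln(n/\epsilon)}\,\|v\|_2$, a norm on $\mathbb{R}^m$. Condition $\mathbf{H}_{s,\infty}(\kappa)$ ($s$ a positive integer, $\kappa>0$) on $H\in\mathbb{R}^{m\times n}$: $\|x\|_\infty\le\|H^TAx\|_\infty+s^{-1}\kappa\|x\|_1$ for all $x\in\mathbb{R}^n$. Penalized $\ell_1$-recovery: $\widehat{x}_{\rm pen}(y)\in\mathrm{Argmin}_{v\in\mathbb{R}^n}\{\|v\|_1+\theta s\|H^T(Av-y)\|_\infty\}$, a Borel function of $y$. $X(s,\upsilon)=\{x\in\mathbb{R}^n:\|x-x^s\|_1\le\upsilon\}$, and for a Borel $\widehat{x}:\mathbb{R}^m\to\mathbb{R}^n$, $$\mathrm{Risk}_p(\widehat{x}(\cdot)|\epsilon,\sigma,s,\upsilon)=\inf\{\delta:\mathrm{Prob}\{\xi:\exists x\in X(s,\upsilon),u\in\mathcal{U}:\|\widehat{x}(Ax+\sigma\xi+u)-x\|_p>\delta\}\le\epsilon\}.$$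 Equivalently, $\mathrm{Risk}_p\le\delta$ iff there is a set $\Xi$ with $\mathrm{Prob}\{\xi\in\Xi\}\ge1-\epsilon$ such that $\|\widehat{x}(Ax+\sigma\xi+u)-x\|_p\le\delta$ for all $\xi\in\Xi$, $x\in X(s,\upsilon)$, $u\in\mathcal{U}$. *)

(* Defs.v *)
From HB Require Import structures.
From mathcomp Require Import all_boot all_order all_algebra.
From mathcomp Require Import all_classical all_reals all_analysis.
From mathcomp Require Import measurable_realfun.
Set Implicit Arguments.
Unset Strict Implicit.
Unset Printing Implicit Defensive.
Import Order.TTheory GRing.Theory Num.Theory.
Import numFieldNormedType.Exports.
Local Open Scope classical_set_scope.
Local Open Scope ring_scope.

(* R^m with its Borel sigma-algebra. *)
Notation borelV R m := (g_sigma_algebraType (@open 'cV[R]_m)).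

Section standard_gaussian.
Context {R : realType}.

Definition cons_cV m (z : measurableTypeR R * borelV R m) : borelV R m.+1 :=
  col_mx (const_mx z.1 : 'cV[R]_1) z.2.

Lemma cons_cV0 m (z : measurableTypeR R * borelV R m) :
  (cons_cV z : 'cV[R]_m.+1) ord0 ord0 = z.1.
Proof.
have := col_mxEu (const_mx z.1 : 'cV[R]_1) (z.2 : 'cV[R]_m) ord0 ord0.
rewrite [RHS]mxE => <-; rewrite /cons_cV.
by rewrite (_ : lshift m ord0 = ord0)//; exact/val_inj.
Qed.

Lemma cons_cVS m (z : measurableTypeR R * borelV R m) (i : 'I_m) :
  (cons_cV z : 'cV[R]_m.+1) (lift ord0 i) ord0 = (z.2 : 'cV[R]_m) i ord0.
Proof.
rewrite -(col_mxEd (const_mx z.1 : 'cV[R]_1) (z.2 : 'cV[R]_m)) /cons_cV.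
by rewrite (_ : rshift 1 i = lift ord0 i)//; exact/val_inj.
Qed.

Lemma measurable_cons_cV m : measurable_fun setT (@cons_cV m).
Proof.
pose T : countType := ('cV[rat]_m.+1 * nat)%type.
pose rV (q : 'cV[rat]_m.+1) : 'cV[R]_m.+1 := map_mx ratr q.
apply: (@measurability _ _ (measurableTypeR R * borelV R m)%type (borelV R m.+1)
  setT (@cons_cV m) (@open 'cV[R]_m.+1)) => //.
move=> _ [V oV <-]; rewrite setTI.
pose B (k : T) : set 'cV[R]_m.+1 := ball (rV k.1) k.2.+1%:R^-1.
pose F (k : T) : set (measurableTypeR R * borelV R m) :=
  if `[< B k `<=` V >] then @cons_cV m @^-1` B k else set0.
have -> : @cons_cV m @^-1` V = \bigcup_k F k.
  apply/seteqP; split => [z /= Vz|z [k _]]; last first.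
    by rewrite /F; case: asboolP => // + /= => /[apply].
  have /nbhs_ballP[e /= e0 eV] := open_nbhs_nbhs (conj oV Vz).
  have [k ke] : exists k : nat, k.+1%:R^-1 < e / 2 :> R.
    have := near_infty_natSinv_lt (PosNum (divr_gt0 e0 (ltr0Sn R 1))).
    by move=> [N _ /(_ N (leqnn _))] /= ?; exists N.
  have k0 : 0 < k.+1%:R^-1 :> R by rewrite invr_gt0.
  have qP i : exists q : rat,
      `|ratr q - (cons_cV z : 'cV[R]_m.+1) i ord0| < k.+1%:R^-1 :> R.
    set a := (cons_cV z : 'cV[R]_m.+1) i ord0.
    have [q] := rat_in_itvoo (ltr_pwDr k0 (lexx a)).
    rewrite in_itv/= => /andP[aq qa]; exists q.
    by rewrite ger0_norm ?subr_ge0 ?(ltW aq)// ltrBlDl.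
  pose q : 'cV[rat]_m.+1 := \col_i sval (cid (qP i)).
  have qz i j : `|rV q i j - (cons_cV z : 'cV[R]_m.+1) i j| < k.+1%:R^-1.
    by rewrite ord1 !mxE; case: cid.
  exists (q, k) => //; rewrite /F; case: asboolP => [_|]; last first.
    case=> y /= [_ yq]; apply: eV; split => // i j.
    rewrite /ball/= (_ : _ - _ = (cons_cV z : 'cV[R]_m.+1) i j - rV q i j
      + (rV q i j - y i j)); last by rewrite addrA subrK.
    rewrite (le_lt_trans (ler_normD _ _))// (splitr e) ltrD//.
      by rewrite distrC (lt_trans (qz i j)).
    by rewrite (lt_trans _ ke)//; exact: yq.
  by split => // i j; rewrite /ball/=; exact: qz.
apply: countable_bigcupT_measurable => // k; rewrite /F.
case: asboolP => // _.
rewrite (_ : _ @^-1` _ = (ball (rV k.1 ord0 ord0) k.2.+1%:R^-1 : set R) `*`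
  (ball (dsubmx (rV k.1 : 'cV[R]_(1 + m))) k.2.+1%:R^-1 : set 'cV[R]_m)).
  apply: measurableX; first by apply: open_measurable; exact: ball_open.
  by apply: sub_sigma_algebra; exact: ball_open.
apply/seteqP; split => [z /= [r0 h]|z /= [h0 [r0 h]]]; split => //.
- by have := h ord0 ord0; rewrite cons_cV0.
- split=> // i j; have := h (lift ord0 i) ord0; rewrite cons_cVS (ord1 j) !mxE.
  by have -> : lift ord0 i = rshift 1 i by exact/val_inj.
- move=> i j; rewrite (ord1 j); case: (unliftP ord0 i) => [i'|] ->.
  rewrite cons_cVS; have := h i' ord0; rewrite !mxE.
  by have -> : lift ord0 i' = rshift 1 i' by exact/val_inj.
  by rewrite cons_cV0.
Qed.

HB.instance Definition _ m :=
  isMeasurableFun.Build _ _ _ _ (@cons_cV m) (measurable_cons_cV (m := m)).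

(* N(0, I_m): N(0, I_0) is the point mass on R^0, and N(0, I_(m+1)) is the law
   of the vector obtained by prepending a N(0, 1) coordinate to an independent
   N(0, I_m) vector. *)
Fixpoint std_gaussian (m : nat) : probability (borelV R m) R :=
  match m with
  | 0 => @dirac _ (borelV R 0) (0 : 'cV[R]_0) R
  | m'.+1 => distribution (normal_prob 0 1 \x std_gaussian m')%E (@cons_cV m')
  end.

(* Box formula: the coordinates are independent with law N(0, 1). *)
Lemma std_gaussian_box m (E : 'I_m -> set (measurableTypeR R)) :
  (forall i, measurable (E i)) ->
  std_gaussian m [set x : 'cV[R]_m | forall i, E i (x i ord0)] =
    (\prod_(i < m) normal_prob 0 1 (E i))%E.
Proof.
elim: m E => [|m IH] E mE.
  by rewrite big_ord0 /= diracE mem_set// => -[].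
have mbox p (G : 'I_p -> set (measurableTypeR R)) :
    (forall i, measurable (G i)) ->
    measurable ([set x : 'cV[R]_p | forall i, G i (x i ord0)] : set (borelV R p)).
  move=> mG; rewrite (_ : mkset _ = \bigcap_(i in [set: 'I_p])
      ((fun x : borelV R p => (x : 'cV[R]_p) i ord0 : measurableTypeR R)
        @^-1` G i)); last first.
    by apply/seteqP; split => [x /= h i _|x /= h i]; [exact: h|exact: (h i I)].
  apply: fin_bigcap_measurable => // i _; rewrite -[X in measurable X]setTI.
  suff h : measurable_fun setT
      (fun x : borelV R p => (x : 'cV[R]_p) i ord0 : measurableTypeR R).
    exact: h.
  apply: (measurability _ (RGenOpens.measurableE R)) => //.
  move=> _ [_ [a [b ->] <-]]; rewrite setTI; apply: sub_sigma_algebra.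
  have /continuousP := @coord_continuous R p 1 i ord0.
  by apply; exact: interval_open.
rewrite big_ord_recl -IH// /= /distribution /pushforward.
rewrite -product_measure1E//=; last exact: (mbox _ (fun i => E (lift ord0 i))).
congr (product_measure1 _ _); apply/seteqP; split => [z /= h|z /= [h0 h] i].
  split => [|i]; first by have := h ord0; rewrite cons_cV0.
  by have := h (lift ord0 i); rewrite cons_cVS.
by case: (unliftP ord0 i) => [i'|] ->; rewrite ?cons_cVS ?cons_cV0.
Qed.

End standard_gaussian.

Section lp_norm.
Context {R : realType}.

(* On matrices `|x| is the largest absolute value of an entry.  Only exponents
   p >= 1 are meaningful. *)
Definition lpnorm k (p : \bar R) (x : 'cV[R]_k) : R :=
  match p with
  | r%:E => (\sum_(i < k) `|x i ord0| `^ r) `^ r^-1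
  | _ => `|x|
  end.

Lemma lpnorm1E k (x : 'cV[R]_k) : lpnorm 1%:E x = \sum_(i < k) `|x i ord0|.
Proof.
rewrite /lpnorm invr1 powRr1; last by apply: sumr_ge0 => i _; exact: powR_ge0.
by apply: eq_bigr => i _; rewrite powRr1.
Qed.

Lemma lpnorm2E k (x : 'cV[R]_k) :
  lpnorm 2%:E x = Num.sqrt (\sum_(i < k) x i ord0 ^+ 2).
Proof.
rewrite /lpnorm powR12_sqrt; last by apply: sumr_ge0 => i _; exact: powR_ge0.
congr Num.sqrt; apply: eq_bigr => i _.
by rewrite powR_mulrn// real_normK// num_real.
Qed.

Lemma lpnormyE k (x : 'cV[R]_k) :
  lpnorm +oo%E x = \big[Num.max/0]_(i < k) `|x i ord0|.
Proof.
rewrite /lpnorm [LHS]mx_normrE; apply/le_anti/andP; split.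
  apply: bigmax_le => [|[i j] _]; first exact: bigmax_ge_id.
  by rewrite (ord1 j); exact: le_bigmax.
apply: bigmax_le => [|i _]; first exact: bigmax_ge_id.
exact: (le_bigmax _ (fun ij => `|x ij.1 ij.2|) (i, ord0)).
Qed.

End lp_norm.

Section sparse_recovery.
Context {R : realType}.

(* Entry j is kept in preference to entry i: it is larger in magnitude, or of
   the same magnitude with a smaller index. *)
Definition preferred n (x : 'cV[R]_n) (i j : 'I_n) : bool :=
  (`|x i ord0| < `|x j ord0|) ||
  ((`|x j ord0| == `|x i ord0|) && (j < i)%N).

(* x^s: the s largest entries are those with fewer than s preferred ones. *)
Definition best_approx n (s : nat) (x : 'cV[R]_n) : 'cV[R]_n :=
  \col_i (if (#|[pred j | preferred x i j]| < s)%N then x i ord0 else 0).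

Definition nearly_sparse n (s : nat) (ups : R) : set 'cV[R]_n :=
  [set x | lpnorm 1%:E (x - best_approx s x) <= ups].

(* n is the number of columns of A, not the dimension of v. *)
Definition nu m (n : nat) (eps sigma : R) (U : set 'cV[R]_m) (v : 'cV[R]_m) : R :=
  sup [set (u^T *m v) ord0 ord0 | u in U] +
  sigma * Num.sqrt (2 * ln (n%:R / eps)) * lpnorm 2%:E v.

(* nu is nonnegative for a nonempty symmetric U and 0 < eps < 1, 0 < sigma, so
   that the neutral element 0 does not affect the maximum. *)
Definition nu_mx m n (eps sigma : R) (U : set 'cV[R]_m) (H : 'M[R]_(m, n)) : R :=
  \big[Num.max/0]_(i < n) nu n eps sigma U (col i H).

Definition condHinf m n (A : 'M[R]_(m, n)) (s : nat) (kappa : R)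
    (H : 'M[R]_(m, n)) : Prop :=
  forall x : 'cV[R]_n,
    lpnorm +oo%E x <=
      lpnorm +oo%E (H^T *m A *m x) + s%:R^-1 * kappa * lpnorm 1%:E x.

Definition pen_objective m n (A H : 'M[R]_(m, n)) (s : nat) (theta : R)
    (y : 'cV[R]_m) (v : 'cV[R]_n) : R :=
  lpnorm 1%:E v + theta * s%:R * lpnorm +oo%E (H^T *m (A *m v - y)).

Definition penalized_recovery m n (A H : 'M[R]_(m, n)) (s : nat) (theta : R)
    (xhat : 'cV[R]_m -> 'cV[R]_n) : Prop :=
  measurable_fun [set: borelV R m] (xhat : borelV R m -> borelV R n) /\
  forall y v, pen_objective A H s theta y (xhat y) <=
              pen_objective A H s theta y v.

(* The event in the definition of the risk is a projection of a Borel set and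
   need not be Borel; its probability is the outer measure induced by
   N(0, I_m), which coincides with N(0, I_m) on Borel sets. *)
Definition risk m n (A : 'M[R]_(m, n)) (U : set 'cV[R]_m) (p : \bar R)
    (xhat : 'cV[R]_m -> 'cV[R]_n) (eps sigma : R) (s : nat) (ups : R) : \bar R :=
  ereal_inf [set delta%:E | delta in [set delta : R |
    (mu_ext (std_gaussian m) [set xi : 'cV[R]_m |
       exists x u, [/\ nearly_sparse s ups x, U u &
         (delta < lpnorm p (xhat (A *m x + sigma *: xi + u) - x))%R]]
     <= eps%:E)%E]].

End sparse_recovery.

(* Main.v *)
Require Import Defs.
From mathcomp Require Import all_boot all_order all_algebra.
From mathcomp Require Import all_classical all_reals all_analysis.
From mathcomp Require Import measurable_realfun ring lra.
Import Order.TTheory GRing.Theory Num.Theory.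
Import numFieldNormedType.Exports.
Local Open Scope classical_set_scope.
Local Open Scope ring_scope.

(** The proof separates a probabilistic event from a deterministic estimate.

    The event Xi is that |h . xi| <= t |h|_2 for every column h of H, with
    t = sqrt (2 ln (n / eps)). A union bound over the n columns gives it
    probability at least 1 - eps as soon as each linear form satisfies
    P(|h . xi| > t |h|_2) <= exp (- t ^ 2 / 2) (gaussian_dotp_tail). To prove
    this tail bound without computing the law of h . xi, put c = (t / |h|_2) h
    and translate the Gaussian measure by c (gaussian_cameron_martin, obtained
    coordinate by coordinate from translation invariance of Lebesgue measure):
    P(c . xi > c . c) is the integral of exp (- c . x - c . c / 2) over the
    half-space where c . x > 0, hence at most exp (- c . c / 2) P(c . xi > 0).
    Adding the bound for - c, whose half-space is disjoint, gives the claim.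

    On Xi, the total noise eta = sigma xi + u satisfies |H^T eta|_oo <= nu(H)
    for every u in the symmetric set U (total_noise_le), by the definition of
    nu.

    The rest holds for every single observation with |H^T eta|_oo <= nu
    (penalized_recovery_error). Let z be the recovery error and I the set of
    the s largest entries of x. Comparing the penalized objective at its
    minimizer and at x yields a cone-type inequality between the l1-masses of z
    on I and off I and s |H^T A z|_oo, while the condition on H bounds |z|_oo by
    |H^T A z|_oo + (kappa / s) |z|_1. Since |z_I|_1 <= s |z|_oo, these combine
    into bounds on |z|_1 and |z|_oo, the former s times the latter, so that
    |z|_p <= |z|_1 ^ (1 / p) |z|_oo ^ (1 - 1 / p) gives the bound on the risk
    (lpnorm_interpolation_le). *)

(** * Shifting a Gaussian measure *)

(** Both sides give length b - a to every half-open interval from a to b, and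
    such intervals determine Lebesgue measure. *)
Lemma lebesgue_measureD (R : realType) (c : R) (E : set R) : measurable E ->
  pushforward lebesgue_measure
    ((fun x => x + c) : measurableTypeR R -> measurableTypeR R) E =
  lebesgue_measure E.
Proof.
move=> mE; apply/esym/lebesgue_measure_unique => //=.
  exact: measurable_funD.
move=> mshift _ [[a b]] _ <-.
rewrite /pushforward (_ : _ @^-1` _ = `]a - c, b - c]%classic); last first.
  by apply/seteqP; split=> x /=; rewrite !in_itv/= ltrBlDr lerBrDr.
rewrite !lebesgue_measure_itv/= !lte_fin ltrBlDr subrK.
by case: ifP => // _; rewrite -!EFinB; congr EFin; ring.
Qed.

Lemma ge0_integral_lebesgue_shift (R : realType) (c : R) (f : R -> \bar R) :
  measurable_fun [set: R] f -> (forall x, (0 <= f x)%E) ->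
  (\int[lebesgue_measure]_x f x = \int[lebesgue_measure]_x f (x + c)%R)%E.
Proof.
move=> mf f0.
pose sh := ((fun x : R => x + c) : measurableTypeR R -> measurableTypeR R).
have mD : measurable_fun setT sh by exact: measurable_funD.
(* The right-hand side, in the shape of an integral against a pushforward. *)
rewrite [RHS](_ : _ =
  (\int[lebesgue_measure]_(x in sh @^-1` setT) (f \o sh) x)%E)//.
rewrite -ge0_integral_pushforward//.
by apply: eq_measure_integral => //= E mE _; exact/esym/lebesgue_measureD.
Qed.

(** The Radon-Nikodym derivative is only known up to a null set; it agrees
    almost everywhere with the explicit density because both have the same
    integral over every measurable set. *)
Lemma ge0_integral_normal_prob (R : realType) (f : R -> \bar R) :
  measurable_fun [set: R] f -> (forall x, (0 <= f x)%E) ->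
  (\int[normal_prob 0 1]_x f x =
   \int[lebesgue_measure]_x (f x * (normal_pdf 0 1 x)%:E))%E.
Proof.
move=> mf f0.
have Nmu := normal_prob_dominates 0 1 : normal_prob 0 1 `<< @lebesgue_measure R.
rewrite -(Radon_Nikodym_SigmaFinite.change_of_variables Nmu)//.
have mp : measurable_fun [set: R] (EFin \o normal_pdf 0 1).
  by apply/measurable_EFinP; exact: measurable_normal_pdf.
have iRN := Radon_Nikodym_SigmaFinite.f_integrable Nmu.
apply: ae_eq_integral => //.
- by apply: emeasurable_funM => //; exact: measurable_int iRN.
- exact: emeasurable_funM.
- apply: ae_eqe_mul2l; apply: integral_ae_eq => // E _ mE.
  by rewrite -Radon_Nikodym_SigmaFinite.f_integral.
Qed.

(** The density of N(0, 1) at x + c is its density at x times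
    exp (- c x - c ^ 2 / 2), so this is translation invariance of Lebesgue
    measure. *)
Lemma normal_cameron_martin (R : realType) (c : R)
    (f : measurableTypeR R -> \bar R) :
  measurable_fun setT f -> (forall x, (0 <= f x)%E) ->
  (\int[normal_prob 0 1]_x f x =
   \int[normal_prob 0 1]_x
     (f (x + c)%R * (expR (- (c * x) - c ^+ 2 / 2))%:E))%E.
Proof.
move=> mf f0.
have mD : measurable_fun [set: R] (fun x : R => x + c).
  exact: measurable_funD.
have mw : measurable_fun [set: R] (fun x : R => expR (- (c * x) - c ^+ 2 / 2)).
  apply: measurableT_comp => //; apply: measurable_funB => //.
  by apply: measurableT_comp => //; exact: measurable_funM.
have mfD : measurable_fun [set: R] (fun x : R => f (x + c)%R).
  exact: (measurableT_comp mf mD).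
rewrite !ge0_integral_normal_prob//; last 2 first.
- by apply: emeasurable_funM => //; exact/measurable_EFinP.
- by move=> x; rewrite mule_ge0// lee_fin expR_ge0.
rewrite (ge0_integral_lebesgue_shift _ c)//; last 2 first.
- apply: emeasurable_funM => //; apply/measurable_EFinP.
  exact: measurable_normal_pdf.
- by move=> x; rewrite mule_ge0// lee_fin normal_pdf_ge0.
apply: eq_integral => x _; rewrite -muleA -EFinM; congr (_ * _%:E)%E.
rewrite normal_pdfE ?oner_neq0// /normal_fun mulrCA -expRD; congr (_ * expR _).
by field.
Qed.

Definition dotp {R : realType} {m} (c x : 'cV[R]_m) : R :=
  \sum_i c i ord0 * x i ord0.

Lemma dotpE (R : realType) m (c x : 'cV[R]_m) :
  (c^T *m x) ord0 ord0 = dotp c x.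
Proof. by rewrite mxE; apply: eq_bigr => i _; rewrite mxE. Qed.

Lemma measurable_coord (R : realType) m (i : 'I_m) :
  measurable_fun setT
    (fun x : borelV R m => (x : 'cV[R]_m) i ord0 : measurableTypeR R).
Proof.
apply: (measurability _ (RGenOpens.measurableE R)) => //.
move=> _ [_ [a [b ->] <-]]; rewrite setTI; apply: sub_sigma_algebra.
have /continuousP := @coord_continuous R m 1 i ord0.
by apply; exact: interval_open.
Qed.

Lemma measurable_dotp (R : realType) m (c : 'cV[R]_m) :
  measurable_fun [set: borelV R m] (dotp c : borelV R m -> R).
Proof.
apply: measurable_sum => i; apply: measurable_funM => //.
exact: measurable_coord.
Qed.

Lemma measurable_addcV (R : realType) m (c : 'cV[R]_m) :
  measurable_fun setT ((fun x : 'cV[R]_m => x + c) : borelV R m -> borelV R m).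
Proof.
apply: (@measurability _ _ (borelV R m) (borelV R m) setT _
  (@open 'cV[R]_m)) => //.
move=> _ [V oV <-]; rewrite setTI.
apply: sub_sigma_algebra.
have /continuousP : continuous (fun x : 'cV[R]_m => x + c).
  move=> x.
  exact: (@cvgD R 'cV[R]_m _ (nbhs x) _ id (cst c) x c cvg_id (cvg_cst c)).
exact.
Qed.

Lemma ge0_integral_std_gaussianS (R : realType) m
    (f : borelV R m.+1 -> \bar R) :
  measurable_fun setT f -> (forall x, (0 <= f x)%E) ->
  (\int[std_gaussian m.+1]_x f x =
   \int[normal_prob 0 1]_x \int[std_gaussian m]_y f (cons_cV (x, y)))%E.
Proof.
move=> mf f0; have mcons := @measurable_cons_cV R m.
have mfc : measurable_fun setT (f \o cons_cV (m := m)).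
  exact: measurableT_comp.
by rewrite /= ge0_integral_pushforward// fubini_tonelli1// => z; exact: f0.
Qed.

(** The density at x of N(- c, I_m) relative to N(0, I_m). *)
Definition shift_weight {R : realType} {m} (c x : 'cV[R]_m) : \bar R :=
  (expR (- dotp c x - dotp c c / 2))%:E.

Lemma shift_weight_ge0 (R : realType) m (c x : 'cV[R]_m) :
  (0 <= shift_weight c x)%E.
Proof. by rewrite lee_fin expR_ge0. Qed.

Lemma measurable_shift_weight (R : realType) m (c : 'cV[R]_m) :
  measurable_fun [set: borelV R m] (shift_weight c : borelV R m -> \bar R).
Proof.
apply/measurable_EFinP; apply: measurableT_comp => //.
apply: measurable_funB => //; apply: measurableT_comp => //.
exact: measurable_dotp.
Qed.

(** The weight is a product over the coordinates, so the shift can be done one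
    coordinate at a time: by induction, the inner Tonelli integral is shifted
    in the last m coordinates, the outer one in the first. *)
Lemma gaussian_cameron_martin (R : realType) m (c : 'cV[R]_m)
    (f : borelV R m -> \bar R) :
  measurable_fun setT f -> (forall x, (0 <= f x)%E) ->
  (\int[std_gaussian m]_x f x =
   \int[std_gaussian m]_x (f ((x : 'cV[R]_m) + c)%R * shift_weight c x))%E.
Proof.
elim: m c f => [|m IH] c f mf f0.
  have mf' : measurable_fun setT (fun x : borelV R 0 =>
      (f ((x : 'cV[R]_0) + c)%R * shift_weight c x)%E).
    apply: emeasurable_funM; last exact: measurable_shift_weight.
    exact: (measurableT_comp mf (measurable_addcV R 0 c)).
  rewrite /= !integral_dirac//= !diracT !mul1e (flatmx0 c) addr0.
  by rewrite /shift_weight /dotp !big_ord0 mul0r subr0 oppr0 expR0 mule1.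
pose c0 := c ord0 ord0; pose c' : 'cV[R]_m := \col_i c (lift ord0 i) ord0.
have dE (z : measurableTypeR R * borelV R m) :
    dotp c (cons_cV z) = c0 * z.1 + dotp c' z.2.
  rewrite /dotp big_ord_recl cons_cV0; congr (_ + _).
  by apply: eq_bigr => i _; rewrite cons_cVS mxE.
have ccE : dotp c c = c0 ^+ 2 + dotp c' c'.
  rewrite /dotp big_ord_recl; congr (_ + _).
  by apply: eq_bigr => i _; rewrite !mxE.
have DE (x : R) (y : borelV R m) :
    (cons_cV (x, y) : 'cV[R]_m.+1) + c = cons_cV (x + c0, (y : 'cV[R]_m) + c').
  apply/colP => i; case: (unliftP ord0 i) => [j|] ->.
    by rewrite mxE !cons_cVS !mxE.
  by rewrite mxE !cons_cV0.
have mfc : measurable_fun setT (f \o cons_cV (m := m)).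
  exact: measurableT_comp.
rewrite !ge0_integral_std_gaussianS//; last 2 first.
- apply: emeasurable_funM; last exact: measurable_shift_weight.
  exact: (measurableT_comp mf (measurable_addcV R m.+1 c)).
- by move=> x; rewrite mule_ge0// shift_weight_ge0.
pose g (z : measurableTypeR R * borelV R m) :=
  (f (cons_cV (z.1, ((z.2 : 'cV[R]_m) + c')%R)) * shift_weight c' z.2)%E.
have mg : measurable_fun setT g.
  apply: emeasurable_funM.
    apply: (measurableT_comp mfc); apply: measurable_fun_pair => //.
    exact: (measurableT_comp (measurable_addcV R m c') measurable_snd).
  exact: (measurableT_comp (measurable_shift_weight R m c') measurable_snd).
have g0 z : (0 <= g z)%E by rewrite mule_ge0// shift_weight_ge0.
transitivity (\int[normal_prob 0 1]_x \int[std_gaussian m]_y g (x, y))%E.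
  apply: eq_integral => x _; rewrite (IH c')//.
  exact: (measurableT_comp mfc (pair1_measurable x)).
have mG := @measurable_fun_fubini_tonelli_F _ _ _ _ R (std_gaussian m) g mg g0.
have G0 x : (0 <= fubini_F (std_gaussian m) g x)%E by exact: integral_ge0.
apply: (etrans (normal_cameron_martin _ c0 _ mG G0)).
apply: eq_integral => x _; rewrite -ge0_integralZr//; last first.
  exact: (measurableT_comp mg
    (pair1_measurable ((x + c0)%R : measurableTypeR R))).
apply: eq_integral => y _.
rewrite /g /= DE -muleA -EFinM -expRD; congr (_ * (expR _)%:E)%E.
by rewrite dE ccE /=; field.
Qed.

(** * Gaussian tails of linear forms *)

Definition halfspace {R : realType} {m} (c : 'cV[R]_m) (a : R) :
    set (borelV R m) :=
  [set x : 'cV[R]_m | a < dotp c x].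

Lemma in_halfspace (R : realType) m (c : 'cV[R]_m) a (x : borelV R m) :
  (x \in halfspace c a) = (a < dotp c x).
Proof. by apply/idP/idP; rewrite inE. Qed.

Lemma measurable_halfspace (R : realType) m (c : 'cV[R]_m) (a : R) :
  measurable (halfspace c a).
Proof.
rewrite (_ : halfspace c a = (dotp c : borelV R m -> R) @^-1` `]a, +oo[).
  by rewrite -[X in measurable X]setTI; exact: measurable_dotp.
by apply/seteqP; split=> x /=; rewrite in_itv/= andbT.
Qed.

Lemma dotpDr (R : realType) m (c x y : 'cV[R]_m) :
  dotp c (x + y) = dotp c x + dotp c y.
Proof. by rewrite -!dotpE mulmxDr mxE. Qed.

Lemma dotpZl (R : realType) m (a : R) (c x : 'cV[R]_m) :
  dotp (a *: c) x = a * dotp c x.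
Proof.
by rewrite /dotp mulr_sumr; apply: eq_bigr => i _; rewrite mxE mulrA.
Qed.

Lemma dotpZr (R : realType) m (a : R) (c x : 'cV[R]_m) :
  dotp c (a *: x) = a * dotp c x.
Proof.
by rewrite /dotp mulr_sumr; apply: eq_bigr => i _; rewrite mxE mulrCA.
Qed.

Lemma dotpNl (R : realType) m (c x : 'cV[R]_m) : dotp (- c) x = - dotp c x.
Proof. by rewrite -scaleN1r dotpZl mulN1r. Qed.

(** Shifting by c maps the half-space { 0 < c . x } onto { c . c < c . x }, and
    on the former the weight exp (- c . x - c . c / 2) is at most
    exp (- c . c / 2). *)
Lemma gaussian_halfspace_shift_le (R : realType) m (c : 'cV[R]_m) :
  (std_gaussian m (halfspace c (dotp c c)) <=
   (expR (- (dotp c c / 2)))%:E * std_gaussian m (halfspace c 0%R))%E.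
Proof.
have mE := measurable_halfspace R m c (dotp c c).
have mF := measurable_halfspace R m c 0.
have mi (E : set (borelV R m)) : measurable E ->
    measurable_fun setT (fun x : borelV R m => (\1_E x)%:E : \bar R).
  by move=> mE'; exact/measurable_EFinP/measurable_indic.
rewrite -(setIT (halfspace c (dotp c c))) -integral_indic//.
rewrite (gaussian_cameron_martin R m c)//; last exact: mi.
rewrite -[in leRHS](setIT (halfspace c 0%R)) -integral_indic//.
rewrite -ge0_integralZl//; last exact: mi.
apply: ge0_le_integral => //.
- by move=> x _; rewrite mule_ge0// shift_weight_ge0.
- apply: emeasurable_funM; last exact: measurable_shift_weight.
  exact: (measurableT_comp (mi _ mE) (measurable_addcV R m c)).
- by apply: emeasurable_funM => //; exact: mi.
move=> x _; rewrite !indicE !in_halfspace dotpDr ltrDr.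
have [c0|c0] := boolP (0 < dotp c (x : 'cV[R]_m)); last by rewrite mul0e mule0.
rewrite mul1e mule1 lee_fin ler_expR; lra.
Qed.

(** The half-spaces { 0 < c . x } and { 0 < - c . x } are disjoint, so their
    probabilities add up to at most 1. This is what avoids the extra factor 2
    that a Chernoff bound on each side would produce, and which the level
    sqrt (2 ln (n / eps)) could not absorb. *)
Lemma gaussian_two_halfspaces_le (R : realType) m (c : 'cV[R]_m) :
  (std_gaussian m (halfspace c (dotp c c) `|` halfspace (- c) (dotp c c)) <=
   (expR (- (dotp c c / 2)))%:E)%E.
Proof.
have mH (b : 'cV[R]_m) a := measurable_halfspace R m b a.
have le1 : (std_gaussian m (halfspace c 0%R) +
    std_gaussian m (halfspace (- c) 0%R) <= 1)%E.
  rewrite -measureU//; first by apply: probability_le1; exact: measurableU.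
  by apply/seteqP; split=> // x [] /=; rewrite /halfspace /= dotpNl; lra.
apply: (@le_trans _ _ (std_gaussian m (halfspace c (dotp c c)) +
                       std_gaussian m (halfspace (- c) (dotp c c)))%E).
  exact: measureU2.
have ccN : dotp (- c) (- c) = dotp c c.
  by rewrite -[- c]scaleN1r dotpZl dotpZr !mulN1r opprK.
apply: (@le_trans _ _ ((expR (- (dotp c c / 2)))%:E *
  (std_gaussian m (halfspace c 0%R) + std_gaussian m (halfspace (- c) 0%R)))%E).
  rewrite ge0_muleDr// leeD//; first exact: gaussian_halfspace_shift_le.
  by rewrite -{1 2}ccN; exact: gaussian_halfspace_shift_le.
by rewrite -[leRHS]mule1 lee_wpmul2l// lee_fin expR_ge0.
Qed.

Lemma abs_dotp_gtE (R : realType) m (h : 'cV[R]_m) (a : R) :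
  [set x : 'cV[R]_m | a < `|dotp h x|] = halfspace h a `|` halfspace (- h) a.
Proof.
apply/seteqP; split=> [x|x [|]]; rewrite /halfspace/= ?dotpNl ltr_normr.
- by move/orP.
- by move=> ->.
- by move=> ->; rewrite orbT.
Qed.

Lemma measurable_abs_dotp_gt (R : realType) m (h : 'cV[R]_m) (a : R) :
  measurable ([set x : 'cV[R]_m | a < `|dotp h x|] : set (borelV R m)).
Proof.
by rewrite abs_dotp_gtE; apply: measurableU; exact: measurable_halfspace.
Qed.

(** The bound for two half-spaces with c = (t / |h|) h, so that c . c = t ^ 2
    and c . x is the normalised linear form scaled by t. The degenerate cases
    h = 0 and t = 0 are trivial. *)
Lemma gaussian_dotp_tail (R : realType) m (h : 'cV[R]_m) (t : R) : 0 <= t ->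
  (std_gaussian m [set x : 'cV[R]_m | (t * lpnorm 2%:E h < `|dotp h x|)%R] <=
   (expR (- (t ^+ 2 / 2)))%:E)%E.
Proof.
move=> t0; have hh0 : 0 <= dotp h h.
  by apply: sumr_ge0 => i _; rewrite -expr2 sqr_ge0.
have hE : lpnorm 2%:E h = Num.sqrt (dotp h h) by rewrite lpnorm2E.
have h2 : lpnorm 2%:E h ^+ 2 = dotp h h by rewrite hE sqr_sqrtr.
(* If h = 0 then the event is empty. *)
have [hn0|hn0] := eqVneq (lpnorm 2%:E h) 0.
  rewrite (_ : mkset _ = set0) ?measure0 ?lee_fin ?expR_ge0//.
  apply/seteqP; split=> // x; rewrite /mkset hn0 mulr0.
  have h0 : h = 0.
    apply/matrixP => i j; rewrite ord1 mxE.
    have /eqP := h2; rewrite hn0 expr0n/= eq_sym psumr_eq0 => [/allP/(_ i)|k _].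
      by rewrite mem_index_enum -expr2 sqrf_eq0 => /(_ isT)/eqP.
    by rewrite -expr2 sqr_ge0.
  by rewrite h0 -(scale0r (0 : 'cV[R]_m)) dotpZl mul0r normr0 ltxx.
have hp : 0 < lpnorm 2%:E h by rewrite lt_def hn0 hE sqrtr_ge0.
set N := lpnorm 2%:E h in h2 hp *.
pose c := (t / N) *: h.
have ccE : dotp c c = t ^+ 2.
  by rewrite dotpZl dotpZr -h2; field; rewrite gt_eqF.
(* If t = 0 then c = 0 carries no information on h, but the bound is 1. *)
have [->|tn0] := eqVneq t 0.
  rewrite (_ : - _ = 0 :> R) ?expR0; last by rewrite expr0n/= mul0r oppr0.
  by apply: probability_le1; exact: measurable_abs_dotp_gt.
have tp : 0 < t by rewrite lt_def tn0.
rewrite -ccE (le_trans _ (gaussian_two_halfspaces_le R m c))// -abs_dotp_gtE.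
rewrite le_measure ?inE//; [exact: measurable_abs_dotp_gt..|].
move=> x /= hx; rewrite ccE dotpZl normrM ger0_norm ?divr_ge0// ?ltW//.
by rewrite mulrAC ltr_pdivlMr// expr2 -mulrA ltr_pM2l.
Qed.

(** * The s largest entries *)

Lemma preferred_irr (R : realType) n (x : 'cV[R]_n) i : preferred x i i = false.
Proof. by rewrite /preferred ltxx ltnn andbF. Qed.

Lemma preferred_trans (R : realType) n (x : 'cV[R]_n) i j k :
  preferred x i j -> preferred x j k -> preferred x i k.
Proof.
rewrite /preferred => /orP[ij|/andP[/eqP ij ji]] /orP[jk|/andP[/eqP jk kj]].
- by rewrite (lt_trans ij jk).
- by rewrite jk ij.
- by rewrite -ij jk.
- by rewrite jk ij eqxx (ltn_trans kj ji) orbT.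
Qed.

Lemma preferred_total (R : realType) n (x : 'cV[R]_n) i j :
  i != j -> preferred x i j || preferred x j i.
Proof.
rewrite /preferred => ij; case: ltgtP => //= _.
by rewrite -neq_ltn eq_sym.
Qed.

Lemma card_preferred_lt (R : realType) n (x : 'cV[R]_n) i j : preferred x i j ->
  (#|[pred k | preferred x j k]| < #|[pred k | preferred x i k]|)%N.
Proof.
move=> ij; apply/proper_card/properP; split.
  by apply/fintype.subsetP => k; rewrite !inE; exact: preferred_trans.
by exists j; rewrite !inE ?preferred_irr.
Qed.

Definition top_entries {R : realType} {n} (s : nat) (x : 'cV[R]_n) :
    {set 'I_n} :=
  [set i | (#|[pred j | preferred x i j]| < s)%N]%SET.

(** The relation preferred is a strict total order, so the number of entries
    preferred to a given one is an injective rank; at most s indices have a rank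
    below s. *)
Lemma card_top_entries (R : realType) n s (x : 'cV[R]_n) :
  (#|top_entries s x| <= s)%N.
Proof.
pose rank i := #|[pred j | preferred x i j]|.
have rank_inj : injective rank.
  move=> i j rij; apply/eqP; apply: contraT => /(preferred_total R n x).
  by move=> /orP[] /card_preferred_lt; rewrite -/(rank i) -/(rank j) rij ltnn.
rewrite cardE -(size_map rank) -[leqRHS](size_iota 0); apply: uniq_leq_size.
  by rewrite (map_inj_uniq rank_inj) enum_uniq.
by move=> _ /mapP[i + ->]; rewrite mem_enum inE mem_iota.
Qed.

Lemma lpnorm1_best_approx (R : realType) n s (x : 'cV[R]_n) :
  lpnorm 1%:E (x - best_approx s x) =
  \sum_(i | i \notin top_entries s x) `|x i ord0|.
Proof.
rewrite lpnorm1E (bigID (fun i => i \in top_entries s x))/= big1 ?add0r => [|i].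
  by apply: eq_bigr => i; rewrite !mxE inE => /negbTE->; rewrite subr0.
by rewrite !mxE inE => ->; rewrite subrr normr0.
Qed.

(** * The deterministic error bound *)

Lemma ler_lpnormy (R : realType) n (x : 'cV[R]_n) i :
  `|x i ord0| <= lpnorm +oo%E x.
Proof. by rewrite lpnormyE; exact: (le_bigmax _ (fun i => `|x i ord0|)). Qed.

Lemma sum_norm_subset_le (R : realType) n s (I : {set 'I_n}) (z : 'cV[R]_n) :
  (#|I| <= s)%N -> \sum_(i in I) `|z i ord0| <= s%:R * lpnorm +oo%E z.
Proof.
move=> Is; apply: (@le_trans _ _ (\sum_(i in I) lpnorm +oo%E z)).
  by apply: ler_sum => i _; exact: ler_lpnormy.
rewrite sumr_const -[leLHS]mulr_natl ler_wpM2r ?ler_nat//.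
exact: normr_ge0.
Qed.

(** In the application zI and zC are the l1-masses of the error on the support
    of the large entries and off it, and q and r are s times the sup-norms of
    H^T A z and of the error z. Chaining the hypotheses through zI <= r gives
    zI + zC <= 2 D + 2 kappa (zI + zC). For r, the first bound enters through
    2 r <= 2 q + 2 kappa (zI + zC) <= r + 2 D + 2 kappa (zI + zC); this is where
    zC >= 0 is used. *)
Lemma cone_error_bounds (R : realFieldType) (kappa D zI zC q r : R) :
  0 <= kappa -> kappa < 1 / 2 -> 0 <= zC -> zI <= r ->
  r <= q + kappa * (zI + zC) -> 2 * q <= zI - zC + 2 * D ->
  zI + zC <= 2 * D / (1 - 2 * kappa) /\ r <= 2 * D / (1 - 2 * kappa).
Proof.
move=> k0 k1 zC0 zIr rq qD; have d0 : 0 < 1 - 2 * kappa by lra.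
have z1 : zI + zC <= 2 * D / (1 - 2 * kappa).
  rewrite ler_pdivlMr//.
  have -> : (zI + zC) * (1 - 2 * kappa) = zI + zC - 2 * (kappa * (zI + zC)).
    by ring.
  lra.
split=> //.
rewrite (le_trans (_ : r <= 2 * (D + kappa * (2 * D / (1 - 2 * kappa)))))//.
  by have := ler_wpM2l k0 z1; lra.
by rewrite le_eqVlt; apply/orP; left; apply/eqP; field; rewrite lt0r_neq0.
Qed.

(** With z the error, optimality of xh against x bounds
    |xh|_1 + 2 s |H^T A z|_oo by |x|_1 + 4 s nu, and splitting the l1-norm of
    xh = x + z over I and its complement turns this into
    2 s |H^T A z|_oo <= |z_I|_1 - |z_C|_1 + 2 (tail + 2 s nu).
    By the condition on H, the left-hand side is at least
    2 |z_I|_1 - 2 kappa |z|_1; the factor 2, which is the penalty parameter, is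
    what turns |z_I|_1 - |z_C|_1 into - |z|_1 when that is subtracted. *)
Lemma penalized_recovery_error (R : realType) m n (A H : 'M[R]_(m, n)) s kappa
    (nu : R) (I : {set 'I_n}) (x xh : 'cV[R]_n) (y : 'cV[R]_m) :
  (0 < s)%N -> 0 <= kappa -> kappa < 1 / 2 -> condHinf A s kappa H ->
  (#|I| <= s)%N ->
  lpnorm +oo%E (H^T *m (A *m x - y)) <= nu ->
  pen_objective A H s 2 y xh <= pen_objective A H s 2 y x ->
  let K := 2 / (1 - 2 * kappa) *
    (s%:R^-1 * (\sum_(i | i \notin I) `|x i ord0|) + 2 * nu) in
  lpnorm 1%:E (xh - x) <= s%:R * K /\ lpnorm +oo%E (xh - x) <= K.
Proof.
move=> s0 k0 k1 HC Is eta_le opt K.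
have s0' : 0 < s%:R :> R by rewrite ltr0n.
set z := xh - x.
set tail := \sum_(i | i \notin I) `|x i ord0|.
pose zI := \sum_(i in I) `|z i ord0|.
pose zC := \sum_(i | i \notin I) `|z i ord0|.
have z1 : lpnorm 1%:E z = zI + zC.
  by rewrite lpnorm1E (bigID (fun i => i \in I)).
have zIle : zI <= s%:R * lpnorm +oo%E z by exact: sum_norm_subset_le.
have zC0 : 0 <= zC by exact: sumr_ge0.
(* Entrywise, |x| - |xh| is at most |z| on I and 2 |x| - |z| off I. *)
have cone : lpnorm 1%:E x - lpnorm 1%:E xh <= zI - zC + 2 * tail.
  rewrite !lpnorm1E -sumrB (bigID (fun i => i \in I))/= -addrA lerD//.
    apply: ler_sum => i _.
    have -> : x i ord0 = xh i ord0 - z i ord0 by rewrite !mxE; ring.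
    have := ler_normB (xh i ord0) (z i ord0).
    lra.
  rewrite addrC mulr_sumr -sumrB; apply: ler_sum => i _.
  have : `|z i ord0| <= `|xh i ord0| + `|x i ord0| by rewrite !mxE ler_normB.
  lra.
have resid : lpnorm +oo%E (H^T *m A *m z) <=
    lpnorm +oo%E (H^T *m (A *m xh - y)) + nu.
  rewrite (_ : H^T *m A *m z = H^T *m (A *m xh - y) - H^T *m (A *m x - y)).
    by rewrite (le_trans (ler_normB _ _))// lerD2l.
  by rewrite -[RHS]mulmxBr opprB addrA subrK -mulmxBr mulmxA.
have HCz := HC z.
move: opt; rewrite /pen_objective => opt.
set qh := lpnorm +oo%E (H^T *m (A *m xh - y)) in resid opt.
set qx := lpnorm +oo%E (H^T *m (A *m x - y)) in eta_le opt.
set q := lpnorm +oo%E (H^T *m A *m z) in resid HCz.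
set ri := lpnorm +oo%E z in zIle HCz *.
set r1 := lpnorm 1%:E z in z1 HCz *.
have sHC : s%:R * ri <= s%:R * q + kappa * r1.
  apply: (le_trans (ler_wpM2l (ltW s0') HCz)).
  by rewrite mulrDr !mulrA divff ?mul1r// gt_eqF.
have sq : 2 * (s%:R * q) <= zI - zC + 2 * (tail + 2 * (s%:R * nu)).
  have sresid := ler_wpM2l (ltW s0') resid.
  have seta := ler_wpM2l (ltW s0') eta_le.
  move: cone opt sresid seta; move: (lpnorm _ x) (lpnorm _ xh) => a b.
  clear; lra.
have KE : s%:R * K = 2 * (tail + 2 * (s%:R * nu)) / (1 - 2 * kappa).
  have d0 : 0 < 1 - 2 * kappa by clear -k1; lra.
  by rewrite /K -/tail; field; rewrite !lt0r_neq0.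
rewrite -[ri <= K](ler_pM2l s0') KE z1.
apply: (cone_error_bounds _ _ _ _ _ (s%:R * q)) => //.
by rewrite -z1.
Qed.

(** |z|_r ^ r <= |z|_1 |z|_oo ^ (r - 1) <= s K ^ r. *)
Lemma lpnorm_interpolation_le (R : realType) n (p : \bar R) (z : 'cV[R]_n)
    (s K : R) :
  (1%:E <= p)%E -> 0 <= s -> lpnorm 1%:E z <= s * K -> lpnorm +oo%E z <= K ->
  lpnorm p z <= s `^ fine p^-1 * K.
Proof.
move=> p1 s0 z1 zy; have K0 : 0 <= K by apply: le_trans zy; exact: normr_ge0.
case: p p1 => [r| |]//; last first.
  by move=> _; rewrite invey/= powRr0 mul1r.
rewrite lee_fin => r1; have r0 : 0 < r by exact: lt_le_trans r1.
rewrite inver gt_eqF//=.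
have rn0 : r != 0 by rewrite gt_eqF.
apply: (@le_trans _ _ ((s * K `^ r) `^ r^-1)).
  apply: ge0_ler_powR; rewrite ?nnegrE ?invr_ge0 ?(ltW r0)//.
  - by apply: sumr_ge0 => i _; exact: powR_ge0.
  - by rewrite mulr_ge0// powR_ge0.
  rewrite -(mulr_powRB1 K0 r0) mulrA.
  apply: (le_trans _ (ler_wpM2r (powR_ge0 _ _) z1)).
  rewrite lpnorm1E mulr_suml; apply: ler_sum => i _.
  rewrite -mulr_powRB1// ler_wpM2l//.
  apply: ge0_ler_powR; rewrite ?nnegrE ?subr_ge0//.
  exact: le_trans (ler_lpnormy _ _ _ _) zy.
by rewrite powRM ?powR_ge0// -powRrM mulfV// powRr1.
Qed.

(** * The noise *)

(** Compactness makes the supremum an upper bound: the supremum of an unbounded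
    set of reals has a junk value. Symmetry gives the absolute value. *)
Lemma abs_dotp_le_sup (R : realType) m (U : set 'cV[R]_m) (h u : 'cV[R]_m) :
  compact U -> (forall v, U v -> U (- v)) -> U u ->
  `|dotp h u| <= sup [set (v^T *m h) ord0 ord0 | v in U].
Proof.
move=> cU symU Uu.
have dC v : (v^T *m h) ord0 ord0 = dotp h v.
  by rewrite dotpE; apply: eq_bigr => i _; rewrite mulrC.
have [M [_ MU]] := compact_bounded cU.
have ubU : has_ubound [set (v^T *m h) ord0 ord0 | v in U].
  exists (\sum_i `|h i ord0| * (M + 1)) => _ [v Uv <-]; rewrite dC.
  apply: ler_sum => i _; apply: (le_trans (ler_norm _)); rewrite normrM.
  apply: ler_wpM2l => //; apply: (le_trans (ler_lpnormy _ _ _ _)).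
  by apply: (MU _ _ _ Uv); rewrite ltrDl.
have ge v : U v -> dotp h v <= sup [set (v^T *m h) ord0 ord0 | v in U].
  by move=> Uv; apply: ub_le_sup => //; exists v; rewrite ?dC.
by rewrite ler_norml lerNl -mulN1r -dotpZr scaleN1r !ge//; exact: symU.
Qed.

Lemma measure_bigsetU_le d (T : measurableType d) (R : realType)
    (mu : {measure set T -> \bar R}) (I : Type) (r : seq I) (F : I -> set T) :
  (forall i, measurable (F i)) ->
  (mu (\big[setU/set0]_(i <- r) F i) <= \sum_(i <- r) mu (F i))%E.
Proof.
move=> mF; elim: r => [|i r IH]; first by rewrite !big_nil measure0.
rewrite !big_cons (le_trans (measureU2 _ _ _))//; last by rewrite leeD2l.
exact: bigsetU_measurable.
Qed.

Definition bounded_noise {R : realType} {m n} (H : 'M[R]_(m, n)) (t : R) :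
    set (borelV R m) :=
  [set xi : 'cV[R]_m |
    forall i, `|dotp (col i H) xi| <= t * lpnorm 2%:E (col i H)].

Lemma bounded_noiseC (R : realType) m n (H : 'M[R]_(m, n)) (t : R) :
  ~` bounded_noise H t = \big[setU/set0]_(i < n)
    [set x : 'cV[R]_m | t * lpnorm 2%:E (col i H) < `|dotp (col i H) x|].
Proof.
rewrite -bigcup_seq; apply/seteqP; split=> x /=.
  move=> /existsNP[i /negP]; rewrite -ltNge => hi; exists i => //=.
  by rewrite mem_index_enum.
by move=> [i _ /= hi] /(_ i); rewrite leNgt hi.
Qed.

Lemma measurable_bounded_noiseC (R : realType) m n (H : 'M[R]_(m, n)) (t : R) :
  measurable (~` bounded_noise H t).
Proof.
rewrite bounded_noiseC; apply: bigsetU_measurable => i _.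
exact: measurable_abs_dotp_gt.
Qed.

(** With t = sqrt (2 ln (n / eps)) each column fails with probability at most
    exp (- t ^ 2 / 2) = eps / n. *)
Lemma gaussian_bounded_noiseC (R : realType) m n (H : 'M[R]_(m, n)) (eps : R) :
  (0 < n)%N -> 0 < eps -> eps < 1 ->
  (std_gaussian m (~` bounded_noise H (Num.sqrt (2 * ln (n%:R / eps))))
    <= eps%:E)%E.
Proof.
move=> n0 e0 e1; set t := Num.sqrt _.
have n0' : 0 < n%:R :> R by rewrite ltr0n.
have ln0 : 0 <= 2 * ln (n%:R / eps).
  rewrite mulr_ge0// ln_ge0// ler_pdivlMr// mul1r (le_trans (ltW e1))//.
  by rewrite ler1n.
have tail : expR (- (t ^+ 2 / 2)) = eps / n%:R.
  rewrite sqr_sqrtr// mulrAC divff// mul1r expRN lnK ?invf_div//.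
  by rewrite posrE divr_gt0.
rewrite bounded_noiseC (le_trans (measure_bigsetU_le _ _ _ _ _ _ _ _))//.
  by move=> i; exact: measurable_abs_dotp_gt.
apply: (@le_trans _ _ (\sum_(i < n) (eps / n%:R)%:E)%E).
  apply: lee_sum => i _; rewrite -tail; apply: gaussian_dotp_tail.
  exact: sqrtr_ge0.
rewrite sumEFin lee_fin sumr_const card_ord -[leLHS]mulr_natr divfK//.
by rewrite gt_eqF.
Qed.

Lemma total_noise_le (R : realType) m n (sigma eps : R) (U : set 'cV[R]_m)
    (H : 'M[R]_(m, n)) (xi u : 'cV[R]_m) :
  0 < sigma -> compact U -> (forall v, U v -> U (- v)) -> U u ->
  bounded_noise H (Num.sqrt (2 * ln (n%:R / eps))) xi ->
  lpnorm +oo%E (H^T *m (sigma *: xi + u)) <= nu_mx eps sigma U H.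
Proof.
move=> s0 cU symU Uu Xi; rewrite lpnormyE.
apply: bigmax_le => [|i _]; first exact: bigmax_ge_id.
apply: (le_trans _ (le_bigmax _ (fun i => nu n eps sigma U (col i H)) i)).
have -> : (H^T *m (sigma *: xi + u)) i ord0 =
    sigma * dotp (col i H) xi + dotp (col i H) u.
  rewrite -dotpZr -dotpDr mxE; apply: eq_bigr => j _.
  by rewrite [in LHS]mxE [in RHS]mxE.
rewrite (le_trans (ler_normD _ _))// addrC lerD//.
  exact: abs_dotp_le_sup.
by rewrite normrM gtr0_norm// -mulrA ler_pM2l//; exact: Xi.
Qed.

(** * Recovery guarantee *)

Theorem proposition4 (R : realType) (m n : nat) (A : 'M[R]_(m, n))
    (sigma eps : R) (U : set 'cV[R]_m) (s : nat) (H : 'M[R]_(m, n)) (kappa : R)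
    (xhat : 'cV[R]_m -> 'cV[R]_n)
    (sigma_gt0 : 0 < sigma) (eps_gt0 : 0 < eps) (eps_lt1 : eps < 1)
    (U_nonempty : U !=set0) (U_convex : convex_set U) (U_compact : compact U)
    (U_symmetric : forall u, U u -> U (- u))
    (s_gt0 : (0 < s)%N) (s_le_n : (s <= n)%N)
    (kappa_gt0 : 0 < kappa) (kappa_lt : kappa < 1 / 2)
    (H_cond : condHinf A s kappa H)
    (xhat_pen : penalized_recovery A H s 2 xhat) :
  (exists Xi : set (borelV R m),
    [/\ measurable Xi,
        ((1 - eps)%:E <= std_gaussian m Xi)%E &
        forall xi : 'cV[R]_m, Xi xi -> forall (x : 'cV[R]_n) (u : 'cV[R]_m), U u ->
          lpnorm 1%:E (xhat (A *m x + sigma *: xi + u) - x) <=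
            2 * lpnorm 1%:E (x - best_approx s x) / (1 - 2 * kappa) +
            4 * s%:R * (nu_mx eps sigma U H / (1 - 2 * kappa)) /\
          lpnorm +oo%E (xhat (A *m x + sigma *: xi + u) - x) <=
            2 * s%:R^-1 * (lpnorm 1%:E (x - best_approx s x) / (1 - 2 * kappa)) +
            4 * nu_mx eps sigma U H / (1 - 2 * kappa)]) /\
  (forall (p : \bar R) (ups : R), (1%:E <= p)%E -> 0 <= ups ->
    (risk A U p xhat eps sigma s ups <=
      (2 * s%:R `^ fine p^-1 / (1 - 2 * kappa) *
        (s%:R^-1 * ups + 2 * nu_mx eps sigma U H))%:E)%E).
Proof.
have s0 : 0 < s%:R :> R by rewrite ltr0n.
have d0 : 0 < 1 - 2 * kappa by lra.
pose Xi := bounded_noise H (Num.sqrt (2 * ln (n%:R / eps))).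
set nuH := nu_mx eps sigma U H.
(* The sup-norm bound for a signal whose l1-distance to sparsity is b; the
   l1-bound is s times it. *)
pose K b := 2 / (1 - 2 * kappa) * (s%:R^-1 * b + 2 * nuH).
have mXiC : measurable (~` Xi) by exact: measurable_bounded_noiseC.
have PXiC : (std_gaussian m (~` Xi) <= eps%:E)%E.
  by apply: gaussian_bounded_noiseC => //; exact: leq_trans s_le_n.
have bounds xi x u : Xi xi -> U u ->
    lpnorm 1%:E (xhat (A *m x + sigma *: xi + u) - x) <=
      s%:R * K (lpnorm 1%:E (x - best_approx s x)) /\
    lpnorm +oo%E (xhat (A *m x + sigma *: xi + u) - x) <=
      K (lpnorm 1%:E (x - best_approx s x)).
  move=> Xixi Uu; rewrite /K lpnorm1_best_approx.
  apply: (penalized_recovery_error _ _ _ A H _ _ _ _ _ _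
    (A *m x + sigma *: xi + u)) => //.
  - exact: ltW.
  - exact: card_top_entries.
  - have -> : A *m x - (A *m x + sigma *: xi + u) = - (sigma *: xi + u).
      by rewrite -addrA opprD addrA subrr sub0r.
    rewrite mulmxN; have := @total_noise_le R m n sigma eps U H xi u.
    by rewrite /lpnorm normrN; exact.
  - by case: xhat_pen => _; exact.
split.
  exists Xi; split.
  - by rewrite -[Xi]setCK; exact: measurableC.
  - by rewrite -[Xi]setCK probability_setC// EFinB leeB.
  - move=> xi Xixi x u Uu; have [b1 by_] := bounds xi x u Xixi Uu.
    split; [apply: (le_trans b1)|apply: (le_trans by_)];
      rewrite /K le_eqVlt; apply/orP; left; apply/eqP; field;
      by rewrite !lt0r_neq0.
move=> p ups p1 ups0; apply: ereal_inf_lbound; eexists; last reflexivity.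
rewrite /=; apply: (le_trans _ PXiC).
(* The exceptional event of the risk lies in the measurable complement of Xi. *)
rewrite -(measurable_mu_extE _ mXiC); apply: le_mu_ext => xi /=.
move=> [x [u [xs Uu]]]; rewrite ltNge => /negP lt_err Xixi; apply: lt_err.
have [b1 by_] := bounds xi x u Xixi Uu.
have KK : K (lpnorm 1%:E (x - best_approx s x)) <= K ups.
  by rewrite /K ler_pM2l ?divr_gt0// lerD2r ler_pM2l ?invr_gt0.
rewrite (_ : 2 * _ / _ * _ = s%:R `^ fine p^-1 * K ups).
  apply: lpnorm_interpolation_le => //.
  - by apply: (le_trans b1); rewrite ler_pM2l.
  - exact: le_trans by_ KK.
by rewrite /K; ring.
Qed.
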